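(* Let $\alpha \geq 0$ be a real number and let $L\subseteq \mathbb{A}^*$, where $\mathbb{A}$ is a finite nonempty alphabet. If $d_\alpha(L)=k$ for some positive integer $k$, then $p_L(n)=O(n^{k(\alpha +1)-1})$. In particular, for every infinite word $x\in \mathbb{A}^{\mathbb{N}}$, if $d_0(x)=k$ for some positive integer $k$, then $p_x(n)=O(n^{k-1})$.
   Context: $\mathbb{A}^*$ is the set of finite words over $\mathbb{A}$; a language is a subset of $\mathbb{A}^*$. For a language $L$, $p_L(n)$ is the number of words of length $n$ in $L$. For an infinite word $x$, $\mathrm{Fac}(x)$ is the set of all finite blocks of consecutive letters of $x$, including the empty word, and $p_x(n)=p_{\mathrm{Fac}(x)}(n)$. $S^k$ denotes the set of all concatenations of $k$ elements of $S$. For real $\alpha\ge 0$, $\mathcal{L}(\alpha)$ is the collection of languages $S$ over some finite nonempty alphabet with $p_S(n)=O(n^\alpha)$. Define $d_\alpha(L)=\inf\{k\ge 1 : L\subseteq S^k \text{ for some } S\in\mathcal{L}(\alpha)\}$, with $\inf\emptyset=+\infty$, and $d_\alpha(x)=d_\alpha(\mathrm{Fac}(x))$. *)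

(* Defs.v *)
From HB Require Import structures.
From mathcomp Require Import all_boot all_order all_algebra finmap.
From mathcomp Require Import all_classical all_reals all_analysis.
Import Order.TTheory GRing.Theory Num.Theory numFieldNormedType.Exports.

Set Implicit Arguments.
Unset Strict Implicit.
Unset Printing Implicit Defensive.

Local Open Scope classical_set_scope.
Local Open Scope ring_scope.

(* Letters are drawn from an arbitrary type [T]; an alphabet is a finite set
   [A : {fset T}], and a language over [A] is a set of words contained in
   [words A].  This way languages over different alphabets can be compared. *)

Definition words (T : choiceType) (A : {fset T}) : set (seq T) :=
  [set w | {subset w <= A}].

(* [fset_set] is the empty set on infinite sets; this never occurs for a
   language over a finite alphabet. *)
Definition complexity (T : choiceType) (L : set (seq T)) (n : nat) : nat :=
  #|` fset_set [set w | L w /\ size w = n]|.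

Definition factors (T : choiceType) (x : nat -> T) : set (seq T) :=
  [set w | exists i n : nat, w = [seq x j | j <- iota i n]].

Definition word_complexity (T : choiceType) (x : nat -> T) (n : nat) : nat :=
  complexity (factors x) n.

Definition language_power (T : choiceType) (S : set (seq T)) (k : nat) :
    set (seq T) :=
  [set w | exists ws : k.-tuple (seq T),
     (forall u, u \in ws -> S u) /\ w = flatten ws].

Definition growth_class (R : realType) (T : choiceType) (alpha : R) :
    set (set (seq T)) :=
  [set S | (exists2 B : {fset T}, B != fset0 & S `<=` words B) /\
     (fun n : nat => (complexity S n)%:R : R) =O_\oo
     (fun n : nat => n%:R `^ alpha)].

Definition growth_dim (R : realType) (T : choiceType) (alpha : R)
    (L : set (seq T)) : \bar R :=
  ereal_inf [set k%:R%:E | k in [set k : nat | (1 <= k)%N /\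
     exists2 S : set (seq T), growth_class alpha S & L `<=` language_power S k]].

Definition word_growth_dim (R : realType) (T : choiceType) (alpha : R)
    (x : nat -> T) : \bar R :=
  growth_dim alpha (factors x).

(* Main.v *)
Require Import Defs.
From HB Require Import structures.
From mathcomp Require Import all_boot all_order all_algebra finmap.
From mathcomp Require Import all_classical all_reals all_analysis.
Import Order.TTheory GRing.Theory Num.Theory numFieldNormedType.Exports.

Set Implicit Arguments.
Unset Strict Implicit.
Unset Printing Implicit Defensive.

Local Open Scope classical_set_scope.
Local Open Scope ring_scope.


(** If the infimum defining the growth dimension equals [k], it is attained,
    being an infimum of integers: [L] is contained in [S^k] for some [S] with
    [p_S(m) = O(m^alpha)].  A word of length [n] in [S^k] is a concatenation of
    [k] words of [S], of lengths at most [n] adding up to [n].  Once the first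
    [k - 1] lengths are chosen, the last one is determined, so there are at most
    [(n + 1)^(k - 1)] choices of lengths; for each of them every factor can be
    chosen in at most [D (n + 1)^alpha] ways.  Hence
      [p_L(n) <= (n + 1)^(k - 1) (D (n + 1)^alpha)^k
               = D^k (n + 1)^(k (alpha + 1) - 1)],
    and [n + 1 <= 2 n] for positive [n] gives the claim.

    The count is [complexity_power], an induction on the exponent based on the
    convolution bound [complexity_concat] for a concatenation of two languages;
    [growth_dim_attained] supplies [S], and [bigO_powR_bound] the constant [D].
    The statement on infinite words is the case [alpha = 0], with
    [k (0 + 1) - 1] read as a natural number. *)

(** [complexity] is the cardinal of an [fset_set], which is meaningful only for
    finite sets; this is the source of finiteness for every language below. *)
Lemma finite_words_of_size (T : choiceType) (B : {fset T}) (n : nat) :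
  finite_set [set w | words B w /\ size w = n].
Proof.
elim: n => [|n IHn].
  apply: (@sub_finite_set _ _ [set [::]]) => //.
  by move=> w [_ /size0nil ->].
apply: (@sub_finite_set _ _
  [set a :: w | a in [set` B] & w in [set w | words B w /\ size w = n]]).
  move=> [|a w] [Bw //= [sz]]; exists a; first by apply: Bw; rewrite mem_head.
  by exists w => //; split=> // b wb; apply: Bw; rewrite inE wb orbT.
exact: finite_image2 (finite_fset B) IHn.
Qed.

Lemma finite_slice (T : choiceType) (B : {fset T}) (L : set (seq T)) (n : nat) :
  L `<=` words B -> finite_set [set w | L w /\ size w = n].
Proof.
move=> LB; apply: sub_finite_set (finite_words_of_size B n).
by move=> w [Lw sz]; split=> //; apply: LB.
Qed.

Lemma le_complexity (T : choiceType) (B : {fset T}) (L M : set (seq T))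
    (n : nat) :
  L `<=` M -> M `<=` words B -> (complexity L n <= complexity M n)%N.
Proof.
move=> LM MB; apply: fsubset_leq_card.
have LB : L `<=` words B by move=> w /LM /MB.
rewrite -fset_set_sub; [|exact: finite_slice LB|exact: finite_slice MB].
by move=> w [/LM Mw sz].
Qed.

Lemma concat_words (T : choiceType) (B : {fset T}) (L M : set (seq T)) :
  L `<=` words B -> M `<=` words B ->
  [set u ++ v | u in L & v in M] `<=` words B.
Proof.
move=> LB MB _ [u Lu [v Mv <-]] a; rewrite mem_cat => /orP[].
  exact: (LB _ Lu).
exact: (MB _ Mv).
Qed.

(** A word of length [n] in the concatenation splits as [u ++ v], and the length
    [i] of [u] forces that of [v].  Only an inequality holds, since a word may
    split in several ways. *)
Lemma complexity_concat (T : choiceType) (B : {fset T}) (L M : set (seq T))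
    (n : nat) :
  L `<=` words B -> M `<=` words B ->
  (complexity [set u ++ v | u in L & v in M] n <=
    \sum_(i < n.+1) complexity L i * complexity M (n - i))%N.
Proof.
move=> LB MB.
have LMB := concat_words LB MB.
pose slice (K : set (seq T)) m := fset_set [set w | K w /\ size w = m].
pose pieces i := [seq u ++ v | u <- slice L i, v <- slice M (n - i)%N].
(* The sum is the length of an explicit list, possibly with repetitions, which
   exhausts the words of length n of the concatenation. *)
have -> : (\sum_(i < n.+1) complexity L i * complexity M (n - i))%N =
    size (flatten [seq pieces i | i <- iota 0 n.+1]).
  rewrite size_flatten /shape -map_comp sumnE big_map.
  rewrite -(big_mkord xpredT (fun i => complexity L i * complexity M (n - i))%N).
  by rewrite /index_iota subn0; apply: eq_bigr => i _; rewrite /= size_allpairs.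
apply: uniq_leq_size; first exact: fset_uniq.
move=> w; rewrite in_fset_set; last exact: finite_slice LMB.
rewrite inE => -[[u Lu [v Mv <-]] szw].
have szn : (size u + size v)%N = n by rewrite -size_cat.
apply/flatten_mapP; exists (size u).
  by rewrite mem_iota add0n ltnS -szn leq_addr.
by apply/allpairsP; exists (u, v); split=> //=;
  rewrite in_fset_set ?inE //=; (apply: finite_slice; eassumption) ||
  by split=> //; rewrite -szn addKn.
Qed.

Lemma language_power1 (T : choiceType) (S : set (seq T)) :
  language_power S 1 `<=` S.
Proof.
move=> _ [ws [Sws ->]]; case/tupleP: ws Sws => u ws Sws.
by rewrite (tuple0 ws) /= cats0; apply: Sws; rewrite /= mem_head.
Qed.

Lemma language_powerS (T : choiceType) (S : set (seq T)) (k : nat) :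
  language_power S k.+1 `<=` [set u ++ v | u in S & v in language_power S k].
Proof.
move=> _ [ws [Sws ->]]; case/tupleP: ws Sws => u ws Sws.
exists u; first by apply: Sws; rewrite /= mem_head.
exists (flatten ws) => //; exists ws; split=> // v wsv.
by apply: Sws; rewrite /= inE wsv orbT.
Qed.

Lemma language_power_words (T : choiceType) (B : {fset T}) (S : set (seq T))
    (k : nat) :
  S `<=` words B -> language_power S k `<=` words B.
Proof.
by move=> SB _ [ws [Sws ->]] a /flattenP[u /Sws /SB]; apply.
Qed.

(** The power of [N + 1] counts the choices of the lengths of all factors but the
    last, whose length is forced; this is why its exponent is one less than the
    number of factors, and where the [- 1] of the final exponent comes from.  A
    bound [c] that is uniform over lengths up to a fixed [N] avoids summing over
    compositions of [n]: in the induction the remaining factors form a word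
    that is no longer, to which the same [c] and [N] apply. *)
Lemma complexity_power (R : realType) (T : choiceType) (B : {fset T})
    (S : set (seq T)) (c : R) (k N n : nat) :
  S `<=` words B -> 0 <= c ->
  (forall m, (m <= N)%N -> (complexity S m)%:R <= c) -> (n <= N)%N ->
  (complexity (language_power S k.+1) n)%:R <= N.+1%:R ^+ k * c ^+ k.+1.
Proof.
move=> SB c0 Sc; elim: k n => [|k IHk] n nN.
  rewrite expr0 mul1r expr1; apply: le_trans (Sc n nN); rewrite ler_nat.
  exact: le_complexity (@language_power1 _ S) SB.
set P := language_power S k.+1.
have PB : P `<=` words B by exact: language_power_words.
have SPB := concat_words SB PB.
have := leq_trans (le_complexity n (@language_powerS _ S k.+1) SPB)
  (complexity_concat n SB PB).
rewrite -(ler_nat R) natr_sum => /le_trans; apply.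
apply: (@le_trans _ _ (\sum_(i < n.+1) c * (N.+1%:R ^+ k * c ^+ k.+1))).
  apply: ler_sum => i _; rewrite natrM; apply: ler_pM => //.
    by apply: Sc; apply: leq_trans nN; rewrite -ltnS.
  by apply: IHk; apply: leq_trans (leq_subr _ _) nN.
rewrite sumr_const card_ord -[leLHS]mulr_natl.
have -> : N.+1%:R ^+ k.+1 * c ^+ k.+2 =
    N.+1%:R * (c * (N.+1%:R ^+ k * c ^+ k.+1)) :> R.
  by rewrite exprS [c ^+ k.+2]exprS -!mulrA [in LHS](mulrCA _ c).
by rewrite ler_wpM2r ?ler_nat ?mulr_ge0 ?exprn_ge0.
Qed.

(** The infimum is below [k + 1], so some admissible [j] is at most [k]; being
    admissible, [j] is also at least the infimum [k]. *)
Lemma growth_dim_attained (R : realType) (T : choiceType) (alpha : R)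
    (L : set (seq T)) (k : nat) :
  growth_dim alpha L = k%:R%:E ->
  exists2 S : set (seq T), growth_class alpha S & L `<=` language_power S k.
Proof.
move=> dimL.
have : (growth_dim alpha L < k.+1%:R%:E)%E by rewrite dimL lte_fin ltr_nat.
move=> /ereal_inf_lt[_ [j [j1 LSj] <-]]; rewrite lte_fin ltr_nat ltnS => jk.
have : (growth_dim alpha L <= j%:R%:E)%E by apply: ereal_inf_lbound; exists j.
rewrite dimL lee_fin ler_nat => kj.
by have -> : k = j by apply/eqP; rewrite eqn_leq kj jk.
Qed.

(** The factors of a long word may be short, so an asymptotic bound has to be made
    valid at every length.  With [n + 1] in place of [n] the right-hand side is at
    least the constant, so it suffices to add the finitely many exceptional values
    to the constant. *)
Lemma bigO_powR_bound (R : realType) (p : nat -> nat) (alpha : R) :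
  0 <= alpha ->
  (fun n => (p n)%:R : R) =O_\oo (fun n => n%:R `^ alpha) ->
  exists2 D : R, 0 <= D & forall n, (p n)%:R <= D * n.+1%:R `^ alpha.
Proof.
move=> alpha0 /eqO_exP[C C0 [N _ pC]].
pose D := C + \sum_(i < N) (p i)%:R; exists D.
  by rewrite addr_ge0 ?(ltW C0)// sumr_ge0.
move=> n; rewrite mulrDl.
have sum0 : 0 <= \sum_(i < N) (p i)%:R :> R by rewrite sumr_ge0.
have [Nn|nN] := leqP N n.
  apply: (@le_trans _ _ (C * n%:R `^ alpha)).
    by have := pC n Nn; rewrite normr_nat ger0_norm ?powR_ge0.
  rewrite -[leLHS]addr0 lerD ?mulr_ge0 ?powR_ge0// ler_pM2l//.
  by rewrite ge0_ler_powR ?nnegrE// ler_nat.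
have pn : (p n)%:R <= \sum_(i < N) (p i)%:R :> R.
  by rewrite (bigD1 (Ordinal nN))//= lerDl sumr_ge0.
rewrite -[leLHS]add0r lerD ?mulr_ge0 ?powR_ge0 ?(ltW C0)//.
apply: (le_trans pn); rewrite ler_peMr//.
by rewrite -[leLHS](powRr0 n.+1%:R) ler_powR ?ler1n.
Qed.

Lemma powR_succ_le (R : realType) (e : R) (n : nat) :
  0 <= e -> (0 < n)%N -> n.+1%:R `^ e <= 2 `^ e * n%:R `^ e.
Proof.
move=> e0 n0; rewrite -powRM// ge0_ler_powR ?nnegrE ?mulr_ge0//.
by rewrite -natrM ler_nat mul2n -addnn -addn1 leq_add2l.
Qed.

Lemma complexity_bigO (R : realType) (T : choiceType) (alpha : R)
    (L : set (seq T)) (k : nat) :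
  0 <= alpha -> (0 < k)%N -> growth_dim alpha L = k%:R%:E ->
  (fun n : nat => (complexity L n)%:R : R) =O_\oo
  (fun n : nat => n%:R `^ (k%:R * (alpha + 1) - 1)).
Proof.
case: k => // k alpha0 _ /growth_dim_attained[S [[B _ SB] Salpha] LS].
have [D D0 SD] := bigO_powR_bound alpha0 Salpha.
have -> : k.+1%:R * (alpha + 1) - 1 = k%:R + alpha * k.+1%:R.
  by rewrite mulrDr mulr1 -natr1 [alpha * _]mulrC addrA addrK addrC.
set e := k%:R + _.
have e0 : 0 <= e by rewrite addr_ge0 ?mulr_ge0.
have powE (n : nat) : n.+1%:R ^+ k * (n.+1%:R `^ alpha) ^+ k.+1 = n.+1%:R `^ e.
  rewrite -powR_mulrn// -[X in _ * X]powR_mulrn ?powR_ge0// -powRrM -powRD//.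
  by rewrite pnatr_eq0 implybT.
(* The summand 1 makes the constant positive even when D vanishes. *)
apply/eqO_exP; exists (D ^+ k.+1 * 2 `^ e + 1).
  by rewrite ltr_wpDl// mulr_ge0 ?exprn_ge0 ?powR_ge0.
exists 1%N => // n n0 /=; rewrite normr_nat ger0_norm ?powR_ge0//.
have Sn m : (m <= n)%N -> (complexity S m)%:R <= D * n.+1%:R `^ alpha.
  move=> mn; apply: (le_trans (SD m)); rewrite ler_wpM2l//.
  by rewrite ge0_ler_powR ?nnegrE// ler_nat.
have c0 : 0 <= D * n.+1%:R `^ alpha by rewrite mulr_ge0 ?powR_ge0.
have Ln : (complexity L n)%:R <= (complexity (language_power S k.+1) n)%:R :> R.
  by rewrite ler_nat; apply: le_complexity LS (language_power_words SB).
apply: (le_trans Ln); apply: (le_trans (complexity_power k SB c0 Sn (leqnn n))).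
rewrite exprMn mulrCA powE.
apply: (@le_trans _ _ (D ^+ k.+1 * (2 `^ e * n%:R `^ e))).
  by rewrite ler_wpM2l ?exprn_ge0// powR_succ_le.
by rewrite mulrA ler_wpM2r ?powR_ge0// lerDl.
Qed.

Theorem proposition3p8 (R : realType) (T : choiceType) (A : {fset T})
    (A_nonempty : A != fset0) :
  (forall (alpha : R) (L : set (seq T)) (k : nat),
     0 <= alpha -> L `<=` words A -> (0 < k)%N ->
     growth_dim alpha L = k%:R%:E ->
     (fun n : nat => (complexity L n)%:R : R) =O_\oo
     (fun n : nat => n%:R `^ (k%:R * (alpha + 1) - 1))) /\
  (forall (x : nat -> T) (k : nat),
     (forall i, x i \in A) -> (0 < k)%N ->
     word_growth_dim (0 : R) x = k%:R%:E ->
     (fun n : nat => (word_complexity x n)%:R : R) =O_\oo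
     (fun n : nat => n%:R ^+ (k - 1) : R)).
Proof.
split=> [alpha L k alpha0 _|x k _ k0 dimx]; first exact: complexity_bigO.
have := complexity_bigO (lexx 0) k0 dimx; congr (_ =O_\oo _).
apply/funext => n; rewrite add0r mulr1 -[1 in LHS]/(1%:R) -natrB//.
by rewrite powR_mulrn.
Qed.
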